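(* For any bounded, polynomially convex Reinhardt domain $D\subset\mathbb{C}^n$ and every $\epsilon>0$, there exist $n$ homogeneous polynomials $p_1,\ldots,p_n$ on $\mathbb{C}^n$ of the same degree, whose only common zero is $0$, such that $$\overline D\subset\{z\in\mathbb{C}^n: |p_k(z)|<1,\ 1\le k\le n\}\subset(1+\epsilon)D.$$
   Context: A domain $D\subset\mathbb{C}^n$ is Reinhardt ($n$-circled, multicircled) if $(z_1,\ldots,z_n)\in D$ implies $(e^{i\phi_1}z_1,\ldots,e^{i\phi_n}z_n)\in D$ for all real $\phi_1,\ldots,\phi_n$. For a bounded Reinhardt domain, being polynomially convex amounts to being complete (if $z\in D$ and $|w_k|\le|z_k|$ for all $k$, then $w\in D$) and logarithmically convex (the set $\log|D|=\{(\log|z_1|,\ldots,\log|z_n|): z\in D,\ z_1\cdots z_n\neq0\}\subset\mathbb{R}^n$ is convex). In particular $0\in D$. Here $(1+\epsilon)D=\{(1+\epsilon)z: z\in D\}$. *)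

(* Defs.v *)
From HB Require Import structures.
From mathcomp Require Export all_boot all_order all_algebra complex.
From mathcomp Require Export all_classical all_reals topology normedtype trigo.
From mathcomp Require mpoly.

Set Implicit Arguments.
Unset Strict Implicit.
Unset Printing Implicit Defensive.

(* The notations of mpoly clash with those of mathcomp-analysis. *)
Import -(notations) mpoly.
Export Order.TTheory GRing.Theory Num.Theory numFieldNormedType.Exports.

Local Open Scope classical_set_scope.
Local Open Scope ring_scope.
Local Open Scope complex_scope.

(* [R[i]] itself carries no topology in the libraries; seen through
   [numClosedFieldType] it gets the one defined by the modulus.  As usual in
   [R[i]], the modulus [`|z|] is an element of [R[i]] with zero imaginary part,
   and [x <= y] means that [y - x] is a nonnegative real.  The space C^n is
   ['rV[Cplx R]_n] with the sup norm. *)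
Definition Cplx (R : realType) : numClosedFieldType := R[i].

Definition ofR (R : realType) (x : R) : Cplx R := x%:C.

(* e^{it} *)
Definition expi (R : realType) (t : R) : Cplx R := cos t +i* sin t.

Definition cpoly (R : realType) (n : nat) := mpoly n (Cplx R).

Definition peval (R : realType) (n : nat) (p : cpoly R n)
    (z : 'rV[Cplx R]_n) : Cplx R :=
  meval (z ord0) p.

(* [p \is d.-homog] in the notation of mpoly *)
Definition homogeneous (R : realType) (n d : nat) (p : cpoly R n) : bool :=
  p \is ishomog1 d mdeg.

Definition domain (R : realType) (n : nat) (D : set 'rV[Cplx R]_n) : Prop :=
  [/\ D !=set0, open D & connected D].

Definition reinhardt (R : realType) (n : nat) (D : set 'rV[Cplx R]_n) : Prop :=
  forall (z : 'rV[Cplx R]_n) (phi : 'I_n -> R),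
    D z -> D (\row_k (expi (phi k) * z ord0 k)).

(* The points z with |p(z)| <= sup_K |p| for every polynomial p; the supremum is
   expressed through the upper bounds of |p| on K. *)
Definition polynomial_hull (R : realType) (n : nat) (K : set 'rV[Cplx R]_n) :
    set 'rV[Cplx R]_n :=
  [set z | forall (p : cpoly R n) (M : R),
     (forall w, K w -> `|peval p w| <= ofR M) -> `|peval p z| <= ofR M].

(* Polynomial convexity of an open set. *)
Definition polynomially_convex (R : realType) (n : nat)
    (D : set 'rV[Cplx R]_n) : Prop :=
  forall K : set 'rV[Cplx R]_n,
    compact K -> K `<=` D -> polynomial_hull K `<=` D.

Definition dilate (R : realType) (n : nat) (r : R) (D : set 'rV[Cplx R]_n) :
    set 'rV[Cplx R]_n :=
  [set ofR r *: z | z in D].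

(* Main.v *)
(** Expanding a polynomial bounded by M on a torus-invariant compact set K by the
    discrete Fourier transform bounds each of its monomials by M on K; applied to
    the powers of the polynomial, this shows that the hull of K is determined by
    monomials.  So every point outside rho D is separated from the closure of D by
    a monomial, and by compactness finitely many weighted monomials c_j z^(a_j),
    raised to a common degree N, suffice.

    To pass from m monomials to n polynomials, perturb the c_j so that no n + 1 of
    the moduli c_j |z^(a_j)| are ever equal: n + 1 exponents in R^n satisfy a linear
    relation, and it is enough that the ln c_j do not satisfy the same relation.
    Quantitatively, at most n of these moduli exceed theta times the largest one,
    F(z), where theta < 1 does not depend on z.  Then
    p_k = sum_j j^k (c_j z^(a_j))^M for k < n satisfies
    const F^M <= max_k |p_k| <= const' F^M for M large, the lower bound because any
    n columns of the Vandermonde matrix (j^k) are independent.  The constants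
    disappear in the M-th root. *)

From mathcomp Require Import ring lra zify interval_inference finmap.
From mathcomp Require Import function_spaces realfun sequences exp.
Require Import Defs.
From mathcomp Require mpoly.

Set Implicit Arguments.
Unset Strict Implicit.
Unset Printing Implicit Defensive.

Import -(notations) mpoly.

Local Open Scope classical_set_scope.
Local Open Scope ring_scope.

Local Notation Cn R n := 'rV[Cplx R]_n.

(** * The modulus and the topology of C^n *)

(** The norm of [Cplx R] takes values in [Cplx R]; its real part lies in [R], where the order is
    total and logarithms make sense. *)
Definition modulus (R : realType) (z : Cplx R) : R := complex.Re `|z|.

Lemma norm_modulus (R : realType) (z : Cplx R) : `|z| = ofR (modulus z).
Proof. by []. Qed.

Lemma le_ofR (R : realType) (x y : R) : (ofR x <= ofR y) = (x <= y).
Proof. exact: lecR. Qed.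

Lemma lt_ofR (R : realType) (x y : R) : (ofR x < ofR y) = (x < y).
Proof. exact: ltcR. Qed.

Lemma ofRM (R : realType) (x y : R) : ofR (x * y) = ofR x * ofR y.
Proof. exact: (rmorphM (real_complex R)). Qed.

Lemma ofRD (R : realType) (x y : R) : ofR (x + y) = ofR x + ofR y.
Proof. exact: (rmorphD (real_complex R)). Qed.

Lemma ofRB (R : realType) (x y : R) : ofR (x - y) = ofR x - ofR y.
Proof. exact: (rmorphB (real_complex R)). Qed.

Lemma ofR_inj (R : realType) : injective (@ofR R).
Proof. exact: complexI. Qed.

Lemma ofR_gt0 (R : realType) (e : Cplx R) : 0 < e -> exists2 d : R, 0 < d & e = ofR d.
Proof.
move=> e0; exists (modulus e); last by rewrite -norm_modulus gtr0_norm.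
by rewrite -lt_ofR -norm_modulus gtr0_norm.
Qed.

Lemma modulus_ge0 (R : realType) (z : Cplx R) : 0 <= modulus z.
Proof. by rewrite -le_ofR -norm_modulus normr_ge0. Qed.

Lemma modulus_eq0 (R : realType) (z : Cplx R) : (modulus z == 0) = (z == 0).
Proof. by rewrite -(inj_eq (@ofR_inj R)) -norm_modulus normr_eq0. Qed.

Lemma modulusM (R : realType) (x y : Cplx R) :
  modulus (x * y) = modulus x * modulus y.
Proof. by apply: ofR_inj; rewrite ofRM -!norm_modulus normrM. Qed.

Lemma modulus1 (R : realType) : modulus (1 : Cplx R) = 1.
Proof. by apply: ofR_inj; rewrite -norm_modulus normr1. Qed.

Lemma modulus0 (R : realType) : modulus (0 : Cplx R) = 0.
Proof. by apply/eqP; rewrite modulus_eq0. Qed.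

Lemma modulusX (R : realType) (x : Cplx R) k : modulus (x ^+ k) = modulus x ^+ k.
Proof. by elim: k => [|k IH]; rewrite ?modulus1// !exprS modulusM IH. Qed.

Lemma modulus_prod (R : realType) (I : Type) (s : seq I) (P : pred I)
    (F : I -> Cplx R) :
  modulus (\prod_(i <- s | P i) F i) = \prod_(i <- s | P i) modulus (F i).
Proof. exact: (big_morph _ (@modulusM R) (modulus1 R)). Qed.

Lemma modulusD (R : realType) (x y : Cplx R) :
  modulus (x + y) <= modulus x + modulus y.
Proof. by rewrite -le_ofR ofRD -!norm_modulus ler_normD. Qed.

Lemma modulus_sum (R : realType) (I : Type) (s : seq I) (P : pred I)
    (F : I -> Cplx R) :
  modulus (\sum_(i <- s | P i) F i) <= \sum_(i <- s | P i) modulus (F i).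
Proof.
elim/big_ind2: _ => [|x a y b xa yb|//]; first by rewrite modulus0.
exact: le_trans (modulusD _ _) (lerD xa yb).
Qed.

Lemma modulus_ofR (R : realType) (x : R) : modulus (ofR x) = `|x|.
Proof.
rewrite /modulus normc_def /= expr0n /= addr0; exact: sqrtr_sqr.
Qed.

Lemma modulus_dist (R : realType) (x y : Cplx R) :
  `|modulus x - modulus y| <= modulus (x - y).
Proof.
rewrite -le_ofR -norm_modulus; apply: le_trans (ler_dist_dist x y).
by rewrite (norm_modulus x) (norm_modulus y) -ofRB norm_modulus modulus_ofR.
Qed.

Lemma modulus_expi (R : realType) (t : R) : modulus (expi t) = 1.
Proof. by rewrite /modulus normc_def /= cos2Dsin2 sqrtr1. Qed.

Lemma expiD (R : realType) (s t : R) : expi (s + t) = expi s * expi t.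
Proof.
rewrite /expi cosD sinD; apply/eqP; rewrite eq_complex /= eqxx /=.
by apply/eqP; rewrite addrC; congr (_ + _); rewrite mulrC.
Qed.

Lemma modulus1_expi (R : realType) (z : Cplx R) :
  modulus z = 1 -> exists t, z = expi t.
Proof.
case: z => a b; rewrite /modulus normc_def /= => h.
have ab : a ^+ 2 + b ^+ 2 = 1.
  by rewrite -[LHS]sqr_sqrtr ?addr_ge0 ?sqr_ge0// h expr1n.
have a1 : -1 <= a <= 1 by nra.
have s1 : 1 - a ^+ 2 = b ^+ 2 by rewrite -ab; ring.
(* [acos] has values in [[0, pi]], where the sine is nonnegative; the lower half-circle takes the
   opposite angle. *)
have [b0|b0] := leP 0 b.
  by exists (acos a); rewrite /expi acosK// sin_acos// s1 sqrtr_sqr ger0_norm.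
exists (- acos a).
by rewrite /expi cosN sinN acosK// sin_acos// s1 sqrtr_sqr ltr0_norm// opprK.
Qed.

Lemma modulus_continuous (R : realType) : continuous (@modulus R).
Proof.
move=> z; apply/(@cvgrPdist_lt _ _ _ (nbhs z) (nbhs_filter z)) => e e0.
have e0' : 0 < ofR e by rewrite -(lt_ofR 0) in e0.
apply: (@filterS _ (nbhs z) (nbhs_filter z) _ _ _ (nbhsx_ballx z _ e0')) => y.
rewrite -ball_normE /= norm_modulus lt_ofR.
exact: le_lt_trans (modulus_dist _ _).
Qed.

Lemma ofR_continuous (R : realType) : continuous (@ofR R).
Proof.
move=> z; apply/cvgrPdist_lt => e /ofR_gt0[d d0 ->].
apply: filterS (nbhsx_ballx z _ d0) => y.
by rewrite -ball_normE /= -ofRB norm_modulus modulus_ofR lt_ofR.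
Qed.

Lemma open_polydisc (R : realType) (n : nat) (D : set (Cn R n))
    (w : Cn R n) :
  open D -> D w ->
  exists2 d : R, 0 < d &
    forall v : Cn R n, (forall k, modulus (v ord0 k - w ord0 k) < d) -> D v.
Proof.
rewrite openE => /[apply]/nbhs_ballP[e /= /ofR_gt0[d d0 ->]] h.
exists d => // v vw; apply: h; split=> [|i j]; first by rewrite (lt_ofR 0).
rewrite (ord1 i).
by rewrite -ball_normE /= distrC norm_modulus lt_ofR.
Qed.

Lemma closure_polydisc (R : realType) (n : nat) (D : set (Cn R n))
    (w : Cn R n) (d : R) :
  closure D w -> 0 < d ->
  exists2 v : Cn R n, D v & forall k, modulus (v ord0 k - w ord0 k) < d.
Proof.
move=> cw d0.
have d0' : 0 < ofR d by rewrite -(lt_ofR 0) in d0.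
have [v [Dv /= [_ bv]]] := cw _ (nbhsx_ballx w (ofR d) d0').
exists v => // k; have := bv ord0 k.
by rewrite -ball_normE /= distrC norm_modulus lt_ofR.
Qed.

Lemma bounded_modulus (R : realType) (n : nat) (D : set (Cn R n)) :
  bounded_set D -> exists2 M : R, 0 < M &
    forall (v : Cn R n) k, D v -> modulus (v ord0 k) <= M.
Proof.
move=> [M [Mr h]].
have r1 : M < ofR (modulus M + 1).
  apply: le_lt_trans (real_ler_norm Mr) _.
  by rewrite norm_modulus lt_ofR ltrDl.
exists (modulus M + 1); first by rewrite ltr_wpDl// modulus_ge0.
move=> v k Dv; rewrite -le_ofR -norm_modulus.
apply: le_trans (h _ r1 _ Dv).
rewrite [leRHS]mx_normE.
exact: (le_bigmax _ (fun i : 'I_1 * 'I_n => `|v i.1 i.2|%:nng) (ord0, k)).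
Qed.

(** Heine-Borel: a square in the complex plane is a continuous image of a compact real square, and a
    product of compact squares is compact. *)
Lemma closed_bounded_compact (R : realType) (n : nat) (A : set (Cn R n)) (M : R) :
  closed A -> (forall (v : Cn R n) k, A v -> modulus (v ord0 k) <= M) -> compact A.
Proof.
move=> cA bA.
pose f (xy : R * R) : Cplx R := ofR xy.1 + 'i%C * ofR xy.2.
have cf : continuous f.
  move=> xy; apply: cvgD.
    apply: (continuous_comp (f := fst) (g := @ofR R)); first exact: cvg_fst.
    exact: ofR_continuous.
  apply: cvgM; first exact: cvg_cst.
  apply: (continuous_comp (f := snd) (g := @ofR R)); first exact: cvg_snd.
  exact: ofR_continuous.
pose Q := f @` (`[-M, M]%classic `*` `[-M, M]%classic).
have cQ : compact Q.
  apply: continuous_compact; first exact: continuous_subspaceT.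
  by apply: compact_setX; exact: segment_compact.
apply: (@subclosed_compact _ _ [set v : Cn R n | forall i, Q (v ord0 i)]) => //.
  exact: (@rV_compact (Cplx R) n (fun=> Q)) (fun=> cQ).
move=> v Av i /=.
have := bA v i Av; case: (v ord0 i) => a b.
rewrite /modulus normc_def /= => h.
have M0 : 0 <= M by apply: le_trans h; exact: sqrtr_ge0.
have h2 : a ^+ 2 + b ^+ 2 <= M ^+ 2.
  rewrite -[leLHS]sqr_sqrtr ?addr_ge0 ?sqr_ge0//.
  by rewrite lerXn2r// nnegrE// sqrtr_ge0.
exists (a, b) => /=.
  by split; rewrite /= in_itv /=; nra.
by rewrite /f /=; apply/eqP; rewrite eq_complex /=; apply/andP; split; apply/eqP; ring.
Qed.

(** * Cauchy estimates for monomials *)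

Definition monomial_modulus (R : realType) (n : nat) (a : multinom n)
    (z : Cn R n) : R :=
  \prod_(k < n) modulus (z ord0 k) ^+ a k.

Lemma monomial_modulus_ge0 (R : realType) (n : nat) (a : multinom n) (z : Cn R n) :
  0 <= monomial_modulus a z.
Proof. by apply: prodr_ge0 => k _; rewrite exprn_ge0 ?modulus_ge0. Qed.

Lemma expiX (R : realType) (t : R) k : expi t ^+ k = expi (t * k%:R).
Proof.
elim: k => [|k IH]; first by rewrite expr0 mulr0 /expi cos0 sin0.
by rewrite exprS IH -natr1 mulrDr mulr1 addrC expiD mulrC.
Qed.

(** If cos t = 1, the double-angle formula gives sin (t/2) = 0, whereas t/2 lies strictly between 0
    and pi. *)
Lemma expi_neq1 (R : realType) (t : R) : 0 < t < 2 * pi -> expi t != 1.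
Proof.
move=> t2; apply/eqP => -[ct _].
have s0 : 0 < sin (t / 2) by apply: sin_gt0_pi; lra.
have : cos (t / 2 + t / 2) = 1 by rewrite [RHS](esym ct); congr cos; lra.
rewrite cosD; have := cos2Dsin2 (t / 2).
by nra.
Qed.

Lemma expi_root1 (R : realType) (N : nat) :
  (0 < N)%N -> expi (2 * pi / N%:R) ^+ N = 1 :> Cplx R.
Proof.
move=> N0; rewrite expiX divfK ?pnatr_eq0 ?gtn_eqF// /expi mulr_natl.
by rewrite -[pi *+ 2]add0r cosD2pi sinD2pi cos0 sin0.
Qed.

Lemma root_of_unity_sum (R : realType) (N k : nat) :
  (0 < k < N)%N -> \sum_(i < N) (expi (2 * pi / N%:R) ^+ k) ^+ i = 0 :> Cplx R.
Proof.
move=> /andP[k0 kN].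
have N0 : 0 < N%:R :> R by rewrite ltr0n (leq_trans _ kN).
have k0' : 0 < k%:R :> R by rewrite ltr0n.
have kN' : k%:R < N%:R :> R by rewrite ltr_nat.
have p0 : 0 < pi :> R := pi_gt0 R.
set x := expi _ ^+ k.
have x1 : x != 1.
  rewrite /x expiX; apply: expi_neq1; apply/andP; split.
    by rewrite !mulr_gt0 ?invr_gt0.
  by rewrite -mulrA -[ltRHS]mulr1 ltr_pM2l ?mulr_gt0// mulrC ltr_pdivrMr// mul1r.
have xN : x ^+ N = 1.
  by rewrite /x exprAC expi_root1 ?expr1n// (leq_trans _ kN).
have := subrX1 x N; rewrite xN subrr => /esym/eqP.
by rewrite mulf_eq0 subr_eq0 (negPf x1) => /eqP.
Qed.

Lemma pevalE (R : realType) (n : nat) (p : cpoly R n) (z : Cn R n) :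
  peval p z = \sum_(m <- msupp p) mcoeff m p * \prod_k z ord0 k ^+ m k.
Proof. exact: mevalE. Qed.

(** Averaging [p] against a character over the [N]-th roots of unity in the torus isolates the
    monomial [a]: [N] exceeds every exponent of [p], so distinct exponents stay distinct modulo [N].
    Invariance of [K] bounds every averaged value by [M]. *)
Lemma cauchy_estimate (R : realType) (n : nat) (K : set (Cn R n)) (p : cpoly R n)
    (M : R) (w : Cn R n) (a : multinom n) :
  reinhardt K -> (forall u, K u -> modulus (peval p u) <= M) -> K w ->
  modulus (mcoeff a p) * monomial_modulus a w <= M.
Proof.
move=> rK pM Kw.
have M0 : 0 <= M := le_trans (modulus_ge0 _) (pM _ Kw).
have [ap|ap] := boolP (a \in msupp p); last first.
  by rewrite (memN_msupp_eq0 ap) modulus0 mul0r.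
pose N := msize p.
have degN m k : m \in msupp p -> (m k < N)%N.
  move=> mp; apply: leq_ltn_trans (msize_mdeg_lt mp).
  by rewrite mdegE (bigD1 k) //= leq_addr.
have N0 : (0 < N)%N by rewrite (leq_ltn_trans _ (msize_mdeg_lt ap)).
pose zeta : Cplx R := expi (2 * pi / N%:R).
pose rot (j : {ffun 'I_n -> 'I_N}) : Cn R n := \row_k (zeta ^+ j k * w ord0 k).
have Krot j : K (rot j).
  have -> : rot j = \row_k (expi (2 * pi / N%:R * (j k)%:R) * w ord0 k).
    by apply/rowP => k; rewrite !mxE /zeta expiX.
  exact: rK.
(* As zeta ^+ N = 1, the exponent N - a k stands for - a k. *)
have dft m : \sum_(j : {ffun 'I_n -> 'I_N}) (\prod_k (zeta ^+ (N - a k)) ^+ j k) *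
      (mcoeff m p * \prod_k rot j ord0 k ^+ m k) =
    mcoeff m p * (\prod_k w ord0 k ^+ m k) *
      \prod_k \sum_(i < N) (zeta ^+ (N - a k + m k)) ^+ i.
  rewrite bigA_distr_bigA /= mulr_sumr; apply: eq_bigr => j _.
  rewrite mulrCA -!mulrA -!big_split /=; congr (_ * _); apply: eq_bigr => k _.
  rewrite mxE exprMn -!exprM mulnDl exprD (mulnC (m k)).
  by rewrite mulrA mulrC.
have key : \sum_(j : {ffun 'I_n -> 'I_N})
      (\prod_k (zeta ^+ (N - a k)) ^+ j k) * peval p (rot j) =
    mcoeff a p * (\prod_k w ord0 k ^+ a k) * N%:R ^+ n.
  under [LHS]eq_bigr => j _ do rewrite pevalE mulr_sumr.
  rewrite exchange_big /= (bigD1_seq a) ?msupp_uniq//=.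
  rewrite [X in _ + X]big_seq_cond [X in _ + X]big1 ?addr0.
    rewrite dft; congr (_ * _).
    under eq_bigr => k _.
      rewrite (subnK (ltnW (degN a k ap))) expi_root1//.
      under eq_bigr do rewrite expr1n.
      rewrite sumr_const card_ord; over.
    by rewrite prodr_const card_ord.
  move=> m /andP[mp ma]; rewrite dft.
  have [k mk] : exists k, m k != a k.
    by apply/existsP; rewrite -negb_forall; apply: contra ma => /forallP h;
       apply/eqP/mnmP => k; apply/eqP.
  rewrite [X in _ * X](bigD1 k) //=; set S := (X in _ * (X * _)); suff -> : S = 0.
    by rewrite mul0r mulr0.
  have aN := degN a k ap; have mN := degN m k mp.
  (* For [m k < a k] the exponent [N - a k + m k] is strictly between 0 and [N]; otherwise a full
     [N] has to be removed first. *)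
  case: (ltngtP (m k) (a k)) mk => // mk _.
    by apply: root_of_unity_sum; lia.
  rewrite {}/S; have -> : (N - a k + m k = N + (m k - a k))%N by lia.
  under eq_bigr => i _ do rewrite exprD expi_root1// mul1r.
  by apply: root_of_unity_sum; lia.
have N0' : 0 < N%:R ^+ n :> R by rewrite exprn_gt0// ltr0n.
rewrite -(ler_pM2r N0') -[X in _ * X]gtr0_norm// -modulus_ofR.
have -> : ofR (N%:R ^+ n) = N%:R ^+ n :> Cplx R.
  by rewrite /ofR rmorphXn rmorph_nat.
have -> : monomial_modulus a w = modulus (\prod_k w ord0 k ^+ a k).
  by rewrite modulus_prod; apply: eq_bigr => k _; rewrite modulusX.
rewrite -!modulusM -key. apply: le_trans (modulus_sum _ _ _) _.
have -> : M * N%:R ^+ n = \sum_(j : {ffun 'I_n -> 'I_N}) M.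
  by rewrite sumr_const card_ffun !card_ord -natrX mulr_natr.
apply: ler_sum => j _; rewrite modulusM modulus_prod big1 ?mul1r; first exact: pM.
by move=> k _; rewrite !modulusX modulus_expi !expr1n.
Qed.

(** * Hulls of torus-invariant sets *)

(** All exponents are below [msize p], so the monomials embed into the functions from ['I_n] to
    ['I_(msize p)]. *)
Lemma size_msupp (R : realType) (n : nat) (p : cpoly R n) :
  (size (msupp p) <= msize p ^ n)%N.
Proof.
case: (posnP (msize p)) => [p0|p0].
  by move/eqP: p0; rewrite mmeasure_msupp0 => /eqP ->.
case E : (msize p) p0 => [//|N] _.
pose f (m : multinom n) : {ffun 'I_n -> 'I_N.+1} := [ffun k => inord (m k)].
have fI : {in msupp p &, injective f}.
  move=> m m' mp mp' /ffunP fm; apply/mnmP => k.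
  have := fm k; rewrite !ffunE => /(congr1 val) /=.
  have lt u : u \in msupp p -> (u k < N.+1)%N.
    move=> up; rewrite -E; apply: leq_ltn_trans (msize_mdeg_lt up).
    by rewrite mdegE (bigD1 k) //= leq_addr.
  by rewrite !inordK ?lt.
rewrite -(size_map f) -[X in (_ <= X ^ _)%N]card_ord -[n in (_ ^ n)%N]card_ord.
rewrite -card_ffun.
have /card_uniqP <- : uniq (map f (msupp p)).
  by rewrite map_inj_in_uniq// msupp_uniq.
exact: max_card.
Qed.

Lemma msizeX_le (R : realType) (n : nat) (p : cpoly R n) s :
  (msize (p ^+ s) <= s * (msize p + 1) + 1)%N.
Proof.
elim: s => [|s IH]; first by rewrite expr0 mul0n add0n msize1.
rewrite exprS; have [->|p0] := eqVneq p 0; first by rewrite mul0r mmeasure0.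
by rewrite mulSn; have := msizeM_le p (p ^+ s); lia.
Qed.

Lemma bernoulli (R : realType) (x : R) t : 0 <= x -> 1 + t%:R * x <= (1 + x) ^+ t.
Proof.
move=> x0; elim: t => [|t IH]; first by rewrite mul0r addr0 expr0.
rewrite exprS -natr1; have : 0 <= t%:R :> R by [].
by nra.
Qed.

(** Suppose x / y = 1 + e with e > 0 and take s = t (n + 1). By Bernoulli the left side is at least
    (1 + t e)^(n+1) after division by y^s, while the polynomial factor is at most (c (1 + t e))^n; a
    [t] with c^n < 1 + t e gives a contradiction. *)
Lemma le_of_pow_le_poly (R : realType) (x y : R) (d n : nat) :
  0 <= x -> 0 <= y ->
  (forall s, x ^+ s <= ((s * d + 1) ^ n)%:R * y ^+ s) -> x <= y.
Proof.
move=> x0 y0 h; rewrite leNgt; apply/negP => yx.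
have {}y0 : 0 < y.
  rewrite lt_def y0 andbT; apply/eqP => yE; move: (h 1%N) yx.
  by rewrite yE !expr1 mulr0 => /le_lt_trans/[apply]; rewrite ltxx.
pose e := x / y - 1.
have e0 : 0 < e by rewrite subr_gt0 ltr_pdivlMr// mul1r.
pose D : R := (n.+1 * d)%:R.
pose c := 1 + D / e.
have D0 : 0 <= D / e by rewrite divr_ge0// ltW.
have [t ct] : exists t : nat, c ^+ n < 1 + t%:R * e.
  exists (Num.bound (c ^+ n / e)).
  rewrite -[ltLHS](divfK (lt0r_neq0 e0)) ltr_wpDl// ltr_pM2r//.
  by rewrite archi_boundP ?divr_ge0 ?exprn_ge0 ?(ltW e0)// addr_ge0.
have te0 : 0 < 1 + t%:R * e by rewrite ltr_pwDl// mulr_ge0// ltW.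
have := h (t * n.+1)%N; rewrite -ler_pdivrMr ?exprn_gt0// -expr_div_n exprM.
have -> : x / y = 1 + e by rewrite /e; ring.
apply/negP; rewrite -ltNge.
apply: (@lt_le_trans _ _ ((1 + t%:R * e) ^+ n.+1)); last first.
  by rewrite lerXn2r ?bernoulli ?nnegrE ?exprn_ge0 ?ltW// addr_gt0.
apply: (@le_lt_trans _ _ ((c * (1 + t%:R * e)) ^+ n)).
  rewrite natrX lerXn2r ?nnegrE ?mulr_ge0 ?(ltW te0) ?addr_ge0//.
  rewrite natrD -mulnA natrM -/D /c.
  have -> : (1 + D / e) * (1 + t%:R * e) = 1 + t%:R * e + D / e + t%:R * D.
    by field; rewrite gt_eqF.
  have : 0 <= t%:R * e by rewrite mulr_ge0// ltW.
  by lra.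
by rewrite exprMn exprSr mulrC ltr_pM2l ?exprn_gt0.
Qed.

(* Summing the Cauchy estimates loses a factor, the number of monomials; for the
   powers p ^+ s it is polynomial in s, hence disappears in the s-th root. *)
Lemma monomial_hull (R : realType) (n : nat) (K : set (Cn R n)) (v : Cn R n) :
  reinhardt K ->
  (forall a B, (forall w, K w -> monomial_modulus a w <= B) ->
     monomial_modulus a v <= B) ->
  polynomial_hull K v.
Proof.
move=> rK mK p M pM; rewrite norm_modulus le_ofR.
have mon0 w : monomial_modulus (@mnm0 n) w = 1 :> R.
  by rewrite /monomial_modulus big1// => k _; rewrite mnm0E.
(* On an empty [K] the constant monomial would satisfy the bound 0 vacuously, yet its value at [v]
   is 1. *)
have [w0 Kw0] : exists w, K w.
  apply/not_existsP => K0.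
  have : monomial_modulus (@mnm0 n) v <= 0 by apply: mK => w /K0.
  by rewrite mon0 ler10.
have M0 : 0 <= M.
  by have := pM _ Kw0; rewrite norm_modulus le_ofR; apply: le_trans (modulus_ge0 _).
apply: (@le_of_pow_le_poly _ _ _ (msize p + 1) n) => //; first exact: modulus_ge0.
move=> s; rewrite -modulusX.
have pX u : peval (p ^+ s) u = peval p u ^+ s by exact: rmorphXn.
have pMs u : K u -> modulus (peval (p ^+ s) u) <= M ^+ s.
  move=> Ku; rewrite pX modulusX lerXn2r ?nnegrE ?modulus_ge0//.
  by rewrite -le_ofR -norm_modulus pM.
rewrite -pX pevalE; apply: le_trans (modulus_sum _ _ _) _.
apply: (@le_trans _ _ (\sum_(m <- msupp (p ^+ s)) M ^+ s)).
  rewrite [leLHS]big_seq [leRHS]big_seq; apply: ler_sum => m ms.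
  have -> : modulus (mcoeff m (p ^+ s) * \prod_k v ord0 k ^+ m k) =
      modulus (mcoeff m (p ^+ s)) * monomial_modulus m v.
    rewrite modulusM modulus_prod; congr (_ * _).
    by apply: eq_bigr => k _; rewrite modulusX.
  have c0 : 0 < modulus (mcoeff m (p ^+ s)).
    by rewrite lt_def modulus_ge0 modulus_eq0 -mcoeff_msupp ms.
  rewrite mulrC -ler_pdivlMr//; apply: mK => w Kw.
  by rewrite ler_pdivlMr// mulrC; exact: (cauchy_estimate m rK pMs Kw).
rewrite big_const_seq count_predT iter_addr_0 -[leLHS]mulr_natl.
rewrite ler_wpM2r ?exprn_ge0 ?M0//.
rewrite ler_nat; apply: leq_trans (size_msupp _) _.
suff leX a b k : (a <= b)%N -> (a ^ k <= b ^ k)%N by apply: leX; exact: msizeX_le.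
by case: k => [|k] ab //; rewrite leq_exp2r.
Qed.

(** * Separation of a Reinhardt domain by monomials *)

Lemma coord_modulus_continuous (R : realType) (n : nat) (k : 'I_n) :
  continuous (fun z : Cn R n => modulus (z ord0 k)).
Proof.
move=> z; apply: (continuous_comp (f := fun z : Cn R n => z ord0 k)).
  exact: (@coord_continuous (Cplx R)).
exact: modulus_continuous.
Qed.

Lemma monomial_modulus_continuous (R : realType) (n : nat) (a : multinom n) :
  continuous (@monomial_modulus R n a).
Proof.
apply: (@continuous_big _ _ _ _ _ (@mul_continuous R)) => k _ z.
apply: (continuous_comp (f := fun z : Cn R n => modulus (z ord0 k))
                        (g := fun x => x ^+ a k)).
  exact: coord_modulus_continuous.
exact: exprn_continuous.
Qed.

Lemma monomial_modulusZ (R : realType) (n : nat) (a : multinom n) (c : Cplx R)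
    (z : Cn R n) :
  monomial_modulus a (c *: z) = modulus c ^+ mdeg a * monomial_modulus a z.
Proof.
rewrite /monomial_modulus mdegE -prodrXr -big_split /=.
by apply: eq_bigr => k _; rewrite mxE modulusM exprMn.
Qed.

Lemma reinhardt_complete (R : realType) (n : nat) (D : set (Cn R n)) (w v : Cn R n) :
  reinhardt D -> polynomially_convex D -> D w ->
  (forall k, modulus (v ord0 k) <= modulus (w ord0 k)) -> D v.
Proof.
move=> rD pD Dw vw.
(* The hull of the torus through w contains the closed polydisc. *)
pose K := [set u : Cn R n | forall k, modulus (u ord0 k) = modulus (w ord0 k)].
have KD : K `<=` D.
  move=> u Ku.
  have /fin_all_exists[phi uE] k : exists t, u ord0 k = expi t * w ord0 k.
    have [w0|w0] := eqVneq (w ord0 k) 0.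
      by exists 0; apply/eqP; rewrite w0 mulr0 -modulus_eq0 Ku w0 modulus0.
    have [|t tE] := @modulus1_expi _ (u ord0 k / w ord0 k).
      apply: (@mulIf _ (modulus (w ord0 k))); first by rewrite modulus_eq0.
      by rewrite -modulusM divfK// mul1r Ku.
    by exists t; rewrite -tE divfK.
  have -> : u = \row_k (expi (phi k) * w ord0 k) by apply/rowP => k; rewrite mxE.
  exact: rD.
have cK : compact K.
  apply: (@closed_bounded_compact _ _ _ (\sum_k modulus (w ord0 k))).
    rewrite (_ : K = \bigcap_k [set u | modulus (u ord0 k) = modulus (w ord0 k)]).
      apply: closed_bigI => k _.
      apply: (@preimage_closed _ _ (fun z : Cn R n => modulus (z ord0 k))
                               [set x | x = _]).
        by move=> z _; exact: coord_modulus_continuous.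
      exact: closed_eq.
    by rewrite predeqE => u; split => [h k _|h k]; exact: h.
  move=> u k Ku; rewrite Ku (bigD1 k) //= lerDl sumr_ge0// => i _.
  exact: modulus_ge0.
have rK : reinhardt K.
  by move=> u phi Ku k; rewrite mxE modulusM modulus_expi mul1r Ku.
apply: (pD K cK KD); apply: monomial_hull rK _ => a B /(_ w (fun=> erefl)).
apply: le_trans; apply: ler_prod => k _; rewrite exprn_ge0 ?modulus_ge0//=.
by rewrite lerXn2r// nnegrE modulus_ge0.
Qed.

(** A point [w] of [D] within (1 - q) |z_k| of [z] in each nonzero coordinate satisfies q |z_k| <=
    |w_k|, and completeness applies. *)
Lemma closure_shrink (R : realType) (n : nat) (D : set (Cn R n)) (z : Cn R n) (q : R) :
  reinhardt D -> polynomially_convex D -> closure D z -> 0 <= q < 1 -> D (ofR q *: z).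
Proof.
move=> rD pD cz /andP[q0 q1].
pose d := \big[Num.min/1]_(k | z ord0 k != 0) ((1 - q) * modulus (z ord0 k)).
have d0 : 0 < d.
  apply: lt_bigmin => // k zk.
  by rewrite mulr_gt0 ?subr_gt0// lt_def modulus_ge0 modulus_eq0 zk.
have [w Dw wz] := closure_polydisc cz d0.
apply: (reinhardt_complete rD pD Dw) => k; rewrite mxE modulusM modulus_ofR ger0_norm//.
have [zk|zk] := eqVneq (z ord0 k) 0; first by rewrite zk modulus0 mulr0 modulus_ge0.
have dk : d <= (1 - q) * modulus (z ord0 k) by apply: bigmin_le_cond.
have := modulus_dist (w ord0 k) (z ord0 k).
by have := wz k; rewrite ler_distl => ? /andP[? ?]; lra.
Qed.

Lemma polydisc_closure (R : realType) (n : nat) (D : set (Cn R n)) (z : Cn R n) :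
  (forall d : R, 0 < d ->
    exists2 v : Cn R n, D v & forall k, modulus (v ord0 k - z ord0 k) < d) ->
  closure D z.
Proof.
move=> h B /nbhs_ballP[e /= /ofR_gt0[d d0 ->]] bB.
have [v Dv vz] := h _ d0; exists v; split => //; apply: bB; split=> [|i k].
  by rewrite (lt_ofR 0).
by rewrite (ord1 i) -ball_normE /= distrC norm_modulus lt_ofR.
Qed.

Lemma reinhardt_closure (R : realType) (n : nat) (D : set (Cn R n)) :
  reinhardt D -> reinhardt (closure D).
Proof.
move=> rD z phi cz; apply: polydisc_closure => d d0.
have [v Dv vz] := closure_polydisc cz d0.
exists (\row_k (expi (phi k) * v ord0 k)); first exact: rD.
by move=> k; rewrite !mxE -mulrBr modulusM modulus_expi mul1r.
Qed.

Lemma ofR_scaleKV (R : realType) (n : nat) (r : R) (z : Cn R n) :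
  r != 0 -> ofR r *: (ofR r^-1 *: z) = z.
Proof. by move=> r0; rewrite scalerA -ofRM mulfV// scale1r. Qed.

(** The closure of [D] divided by [rho] is a compact subset [K] of [D], so its hull stays in [D] and
    misses [z / rho]; by [monomial_hull] some monomial detects this. *)
Lemma monomial_separation (R : realType) (n : nat) (D : set (Cn R n)) (rho : R)
    (z : Cn R n) :
  domain D -> bounded_set D -> reinhardt D -> polynomially_convex D ->
  1 < rho -> ~ D (ofR rho^-1 *: z) ->
  exists (a : multinom n) (c : R),
    [/\ (0 < mdeg a)%N, 0 < c,
        forall w, closure D w -> c * monomial_modulus a w <= 1
      & 1 < c * monomial_modulus a z].
Proof.
move=> [[w0 Dw0] oD _] bD rD pD rho1 nDz.
have rho0 : 0 < rho by lra.
have [M M0 DM] := bounded_modulus bD.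
have cDM w k : closure D w -> modulus (w ord0 k) <= M + 1.
  move=> cw; have [v Dv vw] := closure_polydisc cw ltr01.
  have := modulus_dist (v ord0 k) (w ord0 k).
  have := vw k; have := DM _ k Dv; rewrite ler_distl => ? ? /andP[? ?]; lra.
pose K := [set u : Cn R n | closure D (ofR rho *: u)].
have KD : K `<=` D.
  move=> u Ku; have -> : u = ofR rho^-1 *: (ofR rho *: u).
    have := @ofR_scaleKV R n rho^-1 u; rewrite invrK => -> //.
    by rewrite invr_eq0 gt_eqF.
  apply: closure_shrink => //.
  by rewrite invr_ge0 ltW//= invf_lt1.
have cK : compact K.
  apply: (@closed_bounded_compact _ _ _ (M + 1)).
    apply: preimage_closed; last exact: closed_closure.
    by move=> u _; exact: scaler_continuous.
  move=> u k /cDM => /(_ k); rewrite mxE modulusM modulus_ofR gtr0_norm//.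
  apply: le_trans; rewrite ler_peMl ?modulus_ge0// ltW//.
have rK : reinhardt K.
  move=> u phi Ku; have := @reinhardt_closure _ _ _ rD _ phi Ku.
  rewrite /K /=; congr (closure D _).
  by apply/rowP => k; rewrite !mxE mulrCA.
have [a [B [aB Ba]]] : exists (a : multinom n) (B : R),
    (forall u, K u -> monomial_modulus a u <= B) /\
    B < monomial_modulus a (ofR rho^-1 *: z).
  apply: contrapT => h; apply: nDz; apply: (pD K cK KD).
  apply: monomial_hull rK _ => a B aB.
  by rewrite leNgt; apply/negP => Ba; apply: h; exists a, B.
(* No monomial vanishes at such a point, which makes the bound [B] positive. *)
have [v Dv vk] : exists2 v, D v & forall k, v ord0 k != 0.
  have [d d0 dD] := open_polydisc oD Dw0.
  have d20 : ofR (d / 2) != 0 :> Cplx R.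
    by rewrite -modulus_eq0 modulus_ofR normr_eq0; apply: lt0r_neq0; lra.
  exists (\row_k if w0 ord0 k == 0 then ofR (d / 2) else w0 ord0 k).
    apply: dD => k; rewrite mxE; case: eqP => [->|_].
      by rewrite subr0 modulus_ofR gtr0_norm; lra.
    by rewrite subrr modulus0.
  by move=> k; rewrite mxE; case: ifPn.
have cv : closure D v by exact: subset_closure.
have Kv : K (ofR rho^-1 *: v).
  by rewrite /K /mkset ofR_scaleKV// gt_eqF.
have rho_a : 0 < rho^-1 ^+ mdeg a by rewrite exprn_gt0// invr_gt0.
have monV u : monomial_modulus a (ofR rho^-1 *: u) =
    rho^-1 ^+ mdeg a * monomial_modulus a u.
  by rewrite monomial_modulusZ modulus_ofR gtr0_norm// invr_gt0.
have B0 : 0 < B.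
  apply: lt_le_trans (aB _ Kv); rewrite monV mulr_gt0//.
  by apply: prodr_gt0 => k _; rewrite exprn_gt0// lt_def modulus_ge0 modulus_eq0 vk.
(* Division by [rho] multiplies the monomial by [rho^-1 ^+ mdeg a]; this coefficient turns the bound
   [B] on [K] into 1 on the closure of [D]. *)
exists a, (rho^-1 ^+ mdeg a / B); split.
- rewrite lt0n; apply/eqP => a0.
  have mon1 u : monomial_modulus a u = 1 :> R.
    move/eqP: a0; rewrite mdeg_eq0 => /eqP ->.
    by rewrite /monomial_modulus big1// => k _; rewrite mnm0E.
  by have := aB _ Kv; move: Ba; rewrite !mon1 => /lt_le_trans/[apply]; rewrite ltxx.
- by rewrite divr_gt0.
- move=> w cw; rewrite mulrAC ler_pdivrMr// mul1r -monV; apply: aB.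
  by rewrite /K /mkset ofR_scaleKV// gt_eqF.
- by rewrite mulrAC ltr_pdivlMr// mul1r -monV.
Qed.

Lemma monomial_modulusMn (R : realType) (n : nat) (a : multinom n) k (z : Cn R n) :
  monomial_modulus (mnm_muln a k) z = monomial_modulus a z ^+ k.
Proof.
by rewrite /monomial_modulus -prodrXl; apply: eq_bigr => i _; rewrite mulmnE exprM.
Qed.

Lemma finite_monomial_separation (R : realType) (n : nat) (D : set (Cn R n)) (rho : R) :
  domain D -> bounded_set D -> reinhardt D -> polynomially_convex D -> 1 < rho ->
  exists s : seq (multinom n * R),
    (forall x, x \in s -> [/\ (0 < mdeg x.1)%N, 0 < x.2 &
       forall w, closure D w -> x.2 * monomial_modulus x.1 w <= 1]) /\
    (forall z, ~ D (ofR rho^-1 *: z) ->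
       exists2 x, x \in s & 1 < x.2 * monomial_modulus x.1 z).
Proof.
move=> dD bD rD pD rho1.
have rho0 : 0 < rho by lra.
have [M M0 DM] := bounded_modulus bD.
(* A point with a coordinate of modulus [r] cannot lie in [rho] times [D], whose coordinates are at
   most [rho * M]. *)
pose r := rho * (M + 1).
have r0 : 0 < r by rewrite mulr_gt0// addr_gt0.
pose S := [set z : Cn R n | ~ D (ofR rho^-1 *: z) /\ forall k, modulus (z ord0 k) <= r].
pose good := [set x : multinom n * R | [/\ (0 < mdeg x.1)%N, 0 < x.2 &
       forall w, closure D w -> x.2 * monomial_modulus x.1 w <= 1]].
pose U (x : multinom n * R) := [set z : Cn R n | 1 < x.2 * monomial_modulus x.1 z].
have cS : compact S.
  apply: (@closed_bounded_compact _ _ _ r); last by move=> v k [_]; apply.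
  rewrite (_ : S = ((fun z => ofR rho^-1 *: z) @^-1` (~` D)) `&`
      \bigcap_k [set z : Cn R n | modulus (z ord0 k) <= r]); last first.
    by rewrite predeqE => z; split => -[? h]; split => // k; [move=> _|]; exact: h.
  apply: closedI.
    apply: preimage_closed; first by move=> z _; exact: scaler_continuous.
    by case: dD => _ oD _; exact: open_closedC.
  apply: closed_bigI => k _.
  apply: (@preimage_closed _ _ (fun z : Cn R n => modulus (z ord0 k)) [set x | x <= r]).
    by move=> z _; exact: coord_modulus_continuous.
  exact: closed_le.
have oU x : good x -> open (U x).
  move=> _; apply: (@open_comp _ _
    (fun z : Cn R n => x.2 * monomial_modulus x.1 z) [set y | 1 < y]).
    move=> z _; apply: (continuous_comp (f := monomial_modulus x.1) (g := *%R x.2)).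
      exact: monomial_modulus_continuous.
    exact: mulrl_continuous.
  exact: open_gt.
have SU : S `<=` cover good U.
  move=> z [nDz _].
  have [a [c [a0 c0 ca cz]]] := monomial_separation dD bD rD pD rho1 nDz.
  by exists (a, c).
have [F Fgood SF] : finite_subset_cover good U S.
  by move: cS; rewrite compact_cover; exact.
exists (enum_fset F); split=> [x xF|z nDz].
  by have := Fgood x xF; rewrite inE.
(* A far point is shrunk until its largest coordinate has modulus [r]. Shrinking does not increase
   monomials, so a separation at [t z] carries back to [z]. *)
have [t [/andP[t0 t1] tS]] : exists t : R, 0 <= t <= 1 /\ S (ofR t *: z).
  have [zr|/existsNP[k zk]] := pselect (forall k, modulus (z ord0 k) <= r).
    exists 1; split; first by rewrite ler01 lexx.
    by rewrite (_ : ofR 1 = 1)// scale1r.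
  case: (@arg_maxP _ _ _ k xpredT (fun i => modulus (z ord0 i))) => // i _ zi.
  have ri : r < modulus (z ord0 i).
    by apply: lt_le_trans (zi k isT); rewrite ltNge; apply/negP.
  have i0 : 0 < modulus (z ord0 i) := lt_trans r0 ri.
  have t0 : 0 <= r / modulus (z ord0 i) by rewrite divr_ge0 ?ltW.
  exists (r / modulus (z ord0 i)); split.
    by rewrite t0 ler_pdivrMr// mul1r ltW.
  split=> [/(DM _ i)|l]; last first.
    rewrite mxE modulusM modulus_ofR ger0_norm// mulrAC ler_pdivrMr//.
    by rewrite ler_pM2l//; exact: zi.
  rewrite !mxE !modulusM !modulus_ofR (ger0_norm t0) divfK ?gt_eqF//.
  rewrite gtr0_norm ?invr_gt0// mulKf ?gt_eqF//.
  by apply/negP; rewrite -ltNge ltrDl.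
have [x xF /= xz] := SF _ tS.
exists x => //; apply: lt_le_trans xz _.
have := Fgood x xF; rewrite inE => -[_ x0 _].
rewrite ler_pM2l// monomial_modulusZ modulus_ofR ger0_norm// ler_piMl//.
  exact: monomial_modulus_ge0.
exact: exprn_ile1.
Qed.

Lemma monomial_polyhedron (R : realType) (n : nat) (D : set (Cn R n)) (rho : R) :
  domain D -> bounded_set D -> reinhardt D -> polynomially_convex D -> 1 < rho ->
  exists (N m : nat) (a : 'I_m -> multinom n) (c : 'I_m -> R),
    [/\ (0 < N)%N, forall j, mdeg (a j) = N /\ 0 < c j,
        forall w, closure D w -> forall j, c j * monomial_modulus (a j) w <= 1
      & forall z, ~ D (ofR rho^-1 *: z) ->
          exists j, 1 < c j * monomial_modulus (a j) z].
Proof.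
move=> dD bD rD pD rho1.
have [s [sgood sep]] := finite_monomial_separation dD bD rD pD rho1.
pose x (j : 'I_(size s)) := tnth (in_tuple s) j.
have xs j : x j \in s by exact: mem_tnth.
(* A common multiple of the degrees; raising to the power [e j] preserves comparisons with 1. *)
pose N := (\prod_j mdeg (x j).1)%N.
have N0 : (0 < N)%N.
  by rewrite prodn_gt0// => j; case: (sgood _ (xs j)).
pose e j := (N %/ mdeg (x j).1)%N.
have eN j : (mdeg (x j).1 * e j = N)%N.
  by rewrite /e mulnC divnK// /N (bigD1 j) //= dvdn_mulr.
have e0 j : (0 < e j)%N by move: N0; rewrite -(eN j) muln_gt0 => /andP[].
have xe0 j z : 0 <= (x j).2 * monomial_modulus (x j).1 z.
  by case: (sgood _ (xs j)) => _ ? _; rewrite mulr_ge0 ?monomial_modulus_ge0 ?ltW.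
exists N, (size s), (fun j => mnm_muln (x j).1 (e j)), (fun j => (x j).2 ^+ e j).
split => //.
- move=> j; rewrite mdegMn eN exprn_gt0//; by case: (sgood _ (xs j)).
- move=> w cw j; rewrite monomial_modulusMn -exprMn; apply: exprn_ile1 => //.
  by case: (sgood _ (xs j)) => _ _; exact.
- move=> z /sep[y ys yz].
  have /tnthP[j yE] : y \in in_tuple s by [].
  exists j; rewrite monomial_modulusMn -exprMn exprn_egt1//; last by rewrite /x -yE.
  by rewrite -lt0n.
Qed.

(** * Generic coefficients *)

Lemma modulus_natB (R : realType) (x y : nat) :
  modulus (x%:R - y%:R : Cplx R) = `|x%:R - y%:R|.
Proof. by rewrite -modulus_ofR ofRB /ofR !rmorph_nat. Qed.

Lemma vandermonde_bound (R : realType) (n m : nat) :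
  exists2 A : R, 0 < A &
    forall (J : {set 'I_m}) (j0 : 'I_m), j0 \in J -> (#|J| <= n)%N ->
    forall y : 'I_m -> Cplx R,
      modulus (y j0) <= A * (\sum_(k < n) modulus (\sum_(j < m) j%:R ^+ k * y j) +
                             \sum_(j | j \notin J) modulus (y j)).
Proof.
(* Of degree < n, q vanishes on J except at j0, where it is a nonzero integer. *)
pose q (J : {set 'I_m}) (j0 : 'I_m) : {poly Cplx R} :=
  \prod_(i <- enum (J :\ j0)) ('X - (i%:R)%:P).
pose B J j0 : R :=
  \sum_(k < n) modulus (q J j0)`_k + \sum_(j < m) modulus (q J j0).[j%:R].
have B0 J j0 : 0 <= B J j0.
  by rewrite addr_ge0// sumr_ge0// => k _; exact: modulus_ge0.
(* Summation over the finitely many [J] and [j0] makes the constant independent of both. *)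
exists (1 + \sum_J \sum_j B J j).
  by rewrite ltr_pwDl// !sumr_ge0// => J _; rewrite sumr_ge0.
move=> J j0 Jj0 Jn y.
set T := (X in _ <= _ * X).
have T0 : 0 <= T.
  by rewrite addr_ge0// sumr_ge0// => k _; exact: modulus_ge0.
apply: (@le_trans _ _ (B J j0 * T)); last first.
  rewrite ler_wpM2r// (bigD1 J) //= (bigD1 j0) //= addrCA -addrA lerDl.
  by rewrite !addr_ge0 ?sumr_ge0// => K _; rewrite sumr_ge0.
have szq : (size (q J j0) <= n)%N.
  by rewrite size_prod_XsubC -cardE; move: Jn; rewrite (cardsD1 j0) Jj0.
have qJ (j : 'I_m) : j \in J -> j != j0 -> (q J j0).[j%:R] = 0.
  move=> jJ jj0; apply/eqP; change (root (q J j0) j%:R).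
  rewrite /q -(big_map (fun i : 'I_m => i%:R) xpredT (fun c => 'X - c%:P)).
  rewrite root_prod_XsubC; apply/mapP; exists j => //.
  by rewrite mem_enum !inE jj0.
(* The power sums weighted by the coefficients of [q] add up to the sum of q(j) y_j over all j,
   where only [j0] survives inside [J]. *)
have key : (q J j0).[j0%:R] * y j0 =
    \sum_(k < n) (q J j0)`_k * (\sum_(j < m) j%:R ^+ k * y j) -
    \sum_(j | j \notin J) (q J j0).[j%:R] * y j.
  apply/esym/eqP; rewrite subr_eq; apply/eqP.
  transitivity (\sum_(j < m) (q J j0).[j%:R] * y j).
    under eq_bigr do rewrite mulr_sumr.
    rewrite exchange_big /=; apply: eq_bigr => j _.
    rewrite (horner_coef_wide _ szq) mulr_suml; apply: eq_bigr => k _.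
    by rewrite mulrA.
  rewrite (bigID (mem J)) /= (bigD1 j0) //= -addrA; congr (_ + _).
  by rewrite big1 ?add0r// => j /andP[jJ jj0]; rewrite qJ ?mul0r.
have q1 : 1 <= modulus (q J j0).[j0%:R].
  rewrite horner_prod modulus_prod big_seq.
  elim/big_ind: _ => // [x y1 x1 y11|i]; first by rewrite mulr_ege1.
  rewrite mem_enum !inE => /andP[ij0 _].
  rewrite hornerXsubC modulus_natB.
  case: (ltngtP i j0) => h; last by move: ij0; rewrite (val_inj h) eqxx.
    by rewrite -(natrB _ (ltnW h)) normr_nat ler1n subn_gt0.
  by rewrite distrC -(natrB _ (ltnW h)) normr_nat ler1n subn_gt0.
apply: (@le_trans _ _ (modulus ((q J j0).[j0%:R] * y j0))).
  by rewrite modulusM ler_peMl ?modulus_ge0.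
rewrite key; apply: le_trans (modulusD _ _) _.
rewrite -[X in modulus (- X)]mul1r -mulNr modulusM.
have -> : modulus (-1 : Cplx R) = 1.
  by have := modulus_natB R 0 1; rewrite !sub0r normrN normr1.
rewrite mul1r /B /T; pose S (k : 'I_n) := \sum_(j < m) j%:R ^+ k * y j.
have le1 : modulus (\sum_(k < n) (q J j0)`_k * S k) <=
    (\sum_(k < n) modulus (q J j0)`_k) * \sum_(k < n) modulus (S k).
  apply: le_trans (modulus_sum _ _ _) _; rewrite mulr_suml; apply: ler_sum => k _.
  rewrite modulusM ler_wpM2l ?modulus_ge0// (bigD1 k) //= lerDl sumr_ge0// => i _.
  exact: modulus_ge0.
have le2 : modulus (\sum_(j | j \notin J) (q J j0).[j%:R] * y j) <=
    (\sum_(j < m) modulus (q J j0).[j%:R]) * \sum_(j | j \notin J) modulus (y j).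
  apply: le_trans (modulus_sum _ _ _) _; rewrite mulr_sumr; apply: ler_sum => k _.
  rewrite modulusM ler_wpM2r ?modulus_ge0// (bigD1 k) //= lerDl sumr_ge0// => i _.
  exact: modulus_ge0.
apply: le_trans (lerD le1 le2) _; rewrite -/S.
set a := \sum_(k < n) modulus (q J j0)`_k.
set b := \sum_(j < m) modulus _.
set c := \sum_(k < n) modulus (S k).
set d := \sum_(j | j \notin J) _.
have a0 : 0 <= a by rewrite sumr_ge0// => k _; exact: modulus_ge0.
have b0 : 0 <= b by rewrite sumr_ge0// => k _; exact: modulus_ge0.
have c0 : 0 <= c by rewrite sumr_ge0// => k _; exact: modulus_ge0.
have d0 : 0 <= d by rewrite sumr_ge0// => k _; exact: modulus_ge0.
by nra.
Qed.

(** The numbers [tau / i.+2%:R] for [i < size q] are too many to be all roots of [q]; the offset 2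
    keeps them strictly below [tau]. *)
Lemma nonroot_small (R : realType) (q : {poly R}) (tau : R) :
  q != 0 -> 0 < tau -> exists2 t, 0 < t < tau & q.[t] != 0.
Proof.
move=> q0 tau0.
pose rs := [seq tau / i.+2%:R | i <- iota 0 (size q)].
have urs : uniq rs.
  rewrite map_inj_uniq ?iota_uniq// => i j /(mulfI (lt0r_neq0 tau0))/invr_inj/eqP.
  by rewrite eqr_nat => /eqP[].
have [/(max_poly_roots q0)/(_ urs)|] := boolP (all (root q) rs).
  by rewrite size_map size_iota ltnn.
rewrite -has_predC => /hasP[t /mapP[i _ ->] it]; exists (tau / i.+2%:R) => //.
by rewrite divr_gt0//= ltr_pdivrMr// ltr_pMr// ltr1n.
Qed.

Lemma exponent_relation (R : realType) (n : nat) (a : 'I_n.+1 -> 'I_n -> R) :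
  exists2 l : 'I_n.+1 -> R, exists i, l i != 0 & forall k, \sum_i l i * a i k = 0.
Proof.
pose A := \matrix_(i, k) a i k.
have : kermx A != 0.
  rewrite kermx_eq0 /row_free; apply: contraTneq (rank_leq_col A) => ->.
  by rewrite -ltnNge.
case/rowV0Pn => v /sub_kermxP vA v0; exists (v ord0).
  apply/existsP; apply: contraNT v0; rewrite negb_exists => /forallP h.
  by apply/eqP/rowP => i; rewrite mxE; apply/eqP; rewrite -[_ == _]negbK.
move=> k; have /rowP/(_ k) := vA; rewrite !mxE => {2}<-.
by apply: eq_bigr => i _; rewrite mxE.
Qed.

(* Shifting L j by t ^+ j.+1 turns each linear relation between the levels into a
   nonzero polynomial P f in t. *)
Lemma generic_levels (R : realType) (n m N : nat) (a : 'I_m -> 'I_n -> nat)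
    (L : 'I_m -> R) (tau : R) :
  (0 < N)%N -> (forall j, \sum_k a j k = N)%N -> 0 < tau ->
  exists t delta : R, [/\ 0 < t < tau, 0 < delta &
    forall (x : 'I_n -> R) (s : R) (J : {set 'I_m}),
      (forall j, j \in J ->
         `|L j + t ^+ j.+1 + \sum_k (a j k)%:R * x k - s| <= delta) ->
      (#|J| <= n)%N].
Proof.
move=> N0 aN tau0.
have /choice[l lP] (f : {ffun 'I_n.+1 -> 'I_m}) : exists l : 'I_n.+1 -> R,
    (exists i, l i != 0) /\ forall k, \sum_i l i * (a (f i) k)%:R = 0.
  by have [l l0 lk] := exponent_relation (fun i k => (a (f i) k)%:R : R); exists l.
pose P (f : {ffun 'I_n.+1 -> 'I_m}) : {poly R} :=
  \sum_i l f i *: ((L (f i))%:P + 'X^((f i).+1)).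
(* For injective [f] the powers of X in [P f] are distinct and of positive degree, so the
   coefficient at [(f i0).+1] is exactly [l f i0], untouched by the constants [L]. *)
have P0 (f : {ffun 'I_n.+1 -> 'I_m}) : injective f -> P f != 0.
  move=> fI; have [[i0 li0] _] := lP f; apply: contraNneq li0 => Pf.
  have := coef0 R (f i0).+1; rewrite -Pf coef_sum (bigD1 i0) //= big1.
    by rewrite addr0 coefZ coefD coefC coefXn eqxx add0r mulr1 => ->.
  move=> i ii0; rewrite coefZ coefD coefC coefXn eqSS /= add0r.
  by rewrite (inj_eq val_inj) (inj_eq fI) eq_sym (negPf ii0) mulr0.
have Q0 : \prod_(f : {ffun 'I_n.+1 -> 'I_m} | injectiveb f) P f != 0.
  by apply/prodf_neq0 => f /injectiveP; exact: P0.
have [t tt Qt] := nonroot_small Q0 tau0.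
have Pt (f : {ffun 'I_n.+1 -> 'I_m}) : injectiveb f -> (P f).[t] != 0.
  by move=> fI; move: Qt; rewrite horner_prod => /prodf_neq0; apply.
(* The summand 1 makes [S f] positive and the final comparison strict. *)
pose S f := 1 + \sum_i `|l f i|.
have S0 f : 0 < S f by rewrite ltr_pwDl// sumr_ge0.
pose delta := \big[Num.min/1]_(f : {ffun 'I_n.+1 -> 'I_m} | injectiveb f)
  (`|(P f).[t]| / S f).
exists t, delta; split => //.
  by apply: lt_bigmin => // f fI; rewrite divr_gt0// normr_gt0 Pt.
move=> x s J Jd; rewrite leqNgt; apply/negP => nJ.
pose f : {ffun 'I_n.+1 -> 'I_m} := [ffun i => enum_val (widen_ord nJ i)].
have fI : injective f.
  move=> i j; rewrite !ffunE => /enum_val_inj/(congr1 val) /= ij; exact: val_inj.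
have fJ i : f i \in J by rewrite ffunE enum_valP.
have [_ lk] := lP f.
(* All exponents have the same total degree [N], so the relation also annihilates constants; this
   eliminates [s] below. *)
have lsum : \sum_i l f i = 0.
  have /eqP : N%:R * \sum_i l f i = 0.
    rewrite mulr_sumr.
    transitivity (\sum_k \sum_i l f i * (a (f i) k)%:R); last by rewrite big1.
    rewrite exchange_big /=; apply: eq_bigr => i _.
    by rewrite -mulr_sumr -natr_sum aN mulrC.
  by rewrite mulf_eq0 pnatr_eq0 gtn_eqF//= => /eqP.
have PE : (P f).[t] =
    \sum_i l f i * (L (f i) + t ^+ (f i).+1 + \sum_k (a (f i) k)%:R * x k - s).
  rewrite horner_sum; apply/esym.
  under eq_bigr => i _ do rewrite mulrBr mulrDr.
  rewrite sumrB big_split /= -mulr_suml lsum mul0r subr0.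
  rewrite [X in _ + X](_ : _ = 0) ?addr0.
    by apply: eq_bigr => i _; rewrite hornerZ hornerD hornerC hornerXn.
  under eq_bigr => i _ do rewrite mulr_sumr.
  rewrite exchange_big /= big1// => k _.
  under eq_bigr => i _ do rewrite mulrA.
  by rewrite -mulr_suml lk mul0r.
have fIb : injectiveb f by apply/injectiveP.
have dP : delta * S f <= `|(P f).[t]|.
  by rewrite -ler_pdivlMr//; apply: bigmin_le_cond.
have d0 : 0 < delta.
  by apply: lt_bigmin => // g gI; rewrite divr_gt0// normr_gt0 Pt.
have : `|(P f).[t]| <= delta * \sum_i `|l f i|.
  rewrite PE; apply: le_trans (ler_norm_sum _ _ _) _; rewrite mulr_sumr.
  by apply: ler_sum => i _; rewrite normrM mulrC ler_wpM2r// Jd.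
by move: dP; rewrite /S mulrDr mulr1; lra.
Qed.

(* Also when z ord0 k = 0, where ln 0 = 0: positivity forces b k = 0. *)
Lemma monomial_modulus_expR (R : realType) (n : nat) (b : multinom n) (z : Cn R n) :
  0 < monomial_modulus b z ->
  monomial_modulus b z = expR (\sum_k (b k)%:R * ln (modulus (z ord0 k))).
Proof.
move=> b0; rewrite expR_sum; apply: eq_bigr => k _.
have [z0|z0] := eqVneq (modulus (z ord0 k)) 0.
  have [->|bk] := posnP (b k); first by rewrite expr0 mul0r expR0.
  by move: b0; rewrite /monomial_modulus (bigD1 k) //= z0 expr0n gtn_eqF// mul0r ltxx.
by rewrite expRM_natl lnK// posrE lt_def z0 modulus_ge0.
Qed.

(** In logarithmic coordinates a modulus between theta F and F is a level within [delta] of ln F,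
    where theta = exp (- delta), and multiplying [c j] by [expR (t ^+ j.+1)] is the shift of
    [generic_levels]. *)
Lemma generic_coefficients (R : realType) (n m N : nat) (a : 'I_m -> multinom n)
    (c : 'I_m -> R) (kappa : R) :
  (0 < N)%N -> (forall j, mdeg (a j) = N) -> (forall j, 0 < c j) -> 1 < kappa ->
  exists (c' : 'I_m -> R) (theta : R),
    [/\ 0 < theta < 1, forall j, c j <= c' j <= kappa * c j &
      forall (z : Cn R n) (F : R), 0 < F ->
        (forall j, c' j * monomial_modulus (a j) z <= F) ->
        (#|[set j : 'I_m |
              (theta * F <= c' j * monomial_modulus (a j) z)%R]%SET| <= n)%N].
Proof.
move=> N0 aN c0 kappa1.
(* The bound 1 gives [t ^+ j.+1 <= t], so that [t < ln kappa] controls every shift. *)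
have tau0 : 0 < Num.min 1 (ln kappa) by rewrite lt_min ltr01 ln_gt0.
have aN' j : (\sum_k a j k = N)%N by rewrite -mdegE.
have [t [delta [/andP[t0 tt] d0 H]]] :=
  generic_levels (fun j => ln (c j)) N0 aN' tau0.
move: tt; rewrite lt_min => /andP[t1 tk].
exists (fun j => c j * expR (t ^+ j.+1)), (expR (- delta)); split.
- by rewrite expR_gt0 -expR0 ltr_expR oppr_lt0.
- move=> j; have tj : 0 <= t ^+ j.+1 by rewrite exprn_ge0// ltW.
  have e1 : 1 < expR (t ^+ j.+1) by rewrite expR_gt1 exprn_gt0.
  rewrite ler_peMr ?(ltW (c0 j)) ?(ltW e1)//=.
  rewrite mulrC ler_pM2r// -[leRHS]lnK ?posrE; last by lra.
  rewrite ler_expR ltW//; apply: le_lt_trans tk.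
  by rewrite exprS ler_piMr ?exprn_ile1 ?(ltW t0) ?(ltW t1).
move=> z F F0 cF.
apply: (H (fun k => ln (modulus (z ord0 k))) (ln F)) => j.
rewrite inE => Fj; have := cF j.
have cz0 : 0 < c j * expR (t ^+ j.+1) * monomial_modulus (a j) z.
  by apply: lt_le_trans Fj; rewrite mulr_gt0// expR_gt0.
have mz0 : 0 < monomial_modulus (a j) z.
  by move: cz0; rewrite pmulr_rgt0// mulr_gt0// expR_gt0.
move: Fj; rewrite (monomial_modulus_expR mz0).
rewrite -{1 2}[F]lnK ?posrE// -[c j]lnK ?posrE// -!expRD !ler_expR ler_norml.
rewrite expRK => ? ?; lra.
Qed.

(** * From monomials to n polynomials *)

Lemma pevalZ (R : realType) (n d : nat) (p : cpoly R n) (t : Cplx R) (z : Cn R n) :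
  homogeneous d p -> peval p (t *: z) = t ^+ d * peval p z.
Proof.
move=> /dhomogP hp; rewrite !pevalE mulr_sumr big_seq [RHS]big_seq.
apply: eq_bigr => b bp; rewrite mulrCA; congr (_ * _).
have <- : mdeg b = d by exact: hp.
rewrite mdegE -prodrXr -big_split /=.
by apply: eq_bigr => k _; rewrite mxE exprMn.
Qed.

(** By homogeneity all real multiples of a common zero are common zeros, so a nonzero one would
    contradict boundedness of the polyhedron. *)
Lemma homogeneous_common_zero (R : realType) (n d : nat) (p : 'I_n -> cpoly R n)
    (B : R) (z : Cn R n) :
  (0 < d)%N -> (forall k, homogeneous d (p k)) ->
  (forall v : Cn R n, (forall k, `|peval (p k) v| < 1) ->
     forall i, modulus (v ord0 i) <= B) ->
  (forall k, peval (p k) z = 0) <-> z = 0.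
Proof.
move=> d0 hp pB; split=> [pz|-> k]; last first.
  by have := pevalZ 0 0 (hp k); rewrite scale0r expr0n gtn_eqF// mul0r.
apply/rowP => i; rewrite mxE; apply/eqP; rewrite -modulus_eq0.
apply/negP => /negP zi0.
have zi : 0 < modulus (z ord0 i) by rewrite lt_def zi0 modulus_ge0.
have small t k : `|peval (p k) (ofR t *: z)| < 1.
  by rewrite (pevalZ _ _ (hp k)) pz mulr0 normr0.
have B0 : 0 <= B := le_trans (modulus_ge0 _) (pB _ (small 0) i).
have := pB _ (small ((B + 1) / modulus (z ord0 i))) i.
rewrite mxE modulusM modulus_ofR ger0_norm ?divr_ge0 ?addr_ge0 ?modulus_ge0//.
by rewrite divfK//; lra.
Qed.

(** The weights [w j] will be [j%:R ^+ k], the k-th row of a Vandermonde matrix. *)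
Definition power_sum (R : realType) (n m : nat) (c : 'I_m -> R)
    (a : 'I_m -> multinom n) (M : nat) (w : 'I_m -> Cplx R) : cpoly R n :=
  \sum_j (w j * ofR (c j ^+ M)) *: mpolyX (Cplx R) (mnm_muln (a j) M).

Lemma homogeneous_power_sum (R : realType) (n m N : nat) (c : 'I_m -> R)
    (a : 'I_m -> multinom n) (M : nat) (w : 'I_m -> Cplx R) :
  (forall j, mdeg (a j) = N) -> homogeneous (N * M) (power_sum c a M w).
Proof.
move=> aN; apply: rpred_sum => j _; apply: rpredZ.
by rewrite dhomogX; apply/eqP; rewrite -(aN j); exact: mdegMn.
Qed.

Lemma peval_power_sum (R : realType) (n m : nat) (c : 'I_m -> R)
    (a : 'I_m -> multinom n) (M : nat) (w : 'I_m -> Cplx R) (z : Cn R n) :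
  peval (power_sum c a M w) z =
  \sum_j w j * (ofR (c j ^+ M) * \prod_k z ord0 k ^+ (a j k * M)).
Proof.
rewrite /peval raddf_sum; apply: eq_bigr => j _ /=.
by rewrite mevalZ mevalX -mulrA; under [in RHS]eq_bigr => k _ do rewrite -mulmnE.
Qed.

Lemma modulus_power_term (R : realType) (n : nat) (c : R) (a : multinom n)
    (M : nat) (z : Cn R n) :
  0 <= c ->
  modulus (ofR (c ^+ M) * \prod_k z ord0 k ^+ (a k * M)) =
  (c * monomial_modulus a z) ^+ M.
Proof.
move=> c0; rewrite modulusM modulus_ofR ger0_norm ?exprn_ge0// exprMn; congr (_ * _).
rewrite modulus_prod /monomial_modulus -prodrXl; apply: eq_bigr => k _.
by rewrite modulusX exprM.
Qed.

(** Bernoulli's inequality for the powers of 1/q; the case q = 0 is separate. *)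
Lemma pow_small (R : realType) (q E : R) :
  0 <= q < 1 -> 0 < E -> exists M, E * q ^+ M < 1.
Proof.
move=> /andP[q0 q1] E0.
have [->|q0'] := eqVneq q 0; first by exists 1%N; rewrite expr1 mulr0.
have qp : 0 < q by rewrite lt_def q0'.
have iq : 0 < q^-1 - 1 by rewrite subr_gt0 invf_gt1.
pose M := Num.bound (E / (q^-1 - 1)).
exists M; rewrite -[X in _ * X]invrK -exprVn ltr_pdivrMr ?exprn_gt0 ?invr_gt0// mul1r.
have -> : q^-1 = 1 + (q^-1 - 1) by ring.
apply: lt_le_trans (bernoulli M (ltW iq)).
apply: (@lt_trans _ _ (M%:R * (q^-1 - 1))); last by rewrite ltrDr.
by rewrite -ltr_pdivrMr// archi_boundP// divr_ge0 ?ltW.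
Qed.

(** The Vandermonde bound is applied to the largest term X and the set [J] of terms comparable to
    it. The terms outside [J] contribute at most A m theta^M X <= X / 2, which is absorbed on the
    left. *)
Lemma power_sum_lower_bound (R : realType) (n m M : nat) (a : 'I_m -> multinom n)
    (c : 'I_m -> R) (theta A : R) (z : Cn R n) (b : R) (j1 : 'I_m) :
  (forall j, 0 < c j) -> 0 < theta -> 0 <= A ->
  (forall (J : {set 'I_m}) (j0 : 'I_m), j0 \in J -> (#|J| <= n)%N ->
    forall y : 'I_m -> Cplx R,
      modulus (y j0) <= A * (\sum_(k < n) modulus (\sum_(j < m) j%:R ^+ k * y j) +
                             \sum_(j | j \notin J) modulus (y j))) ->
  (forall F : R, 0 < F -> (forall j, c j * monomial_modulus (a j) z <= F) ->
    (#|[set j : 'I_m | (theta * F <= c j * monomial_modulus (a j) z)%R]%SET| <= n)%N) ->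
  theta <= 1 -> 0 < c j1 * monomial_modulus (a j1) z ->
  2 * A * m%:R * theta ^+ M <= 1 ->
  (forall k : 'I_n, modulus (peval (power_sum c a M (fun j => j%:R ^+ k)) z) <= b) ->
  (c j1 * monomial_modulus (a j1) z) ^+ M <= 2 * A * n%:R * b.
Proof.
move=> c0 theta0 A0 vdm generic theta1 gj1 AM pb.
pose g j := c j * monomial_modulus (a j) z.
have g0 j : 0 <= g j by rewrite mulr_ge0 ?monomial_modulus_ge0 ?(ltW (c0 j)).
case: (@arg_maxP _ _ _ j1 xpredT g) => // j0 _ gmax.
have gle : g j1 ^+ M <= g j0 ^+ M by rewrite lerXn2r ?nnegrE//; exact: gmax.
apply: le_trans gle _.
pose y (j : 'I_m) : Cplx R := ofR (c j ^+ M) * \prod_k z ord0 k ^+ (a j k * M).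
have yE j : modulus (y j) = g j ^+ M by rewrite modulus_power_term ?(ltW (c0 j)).
have gj0 : 0 < g j0 by apply: lt_le_trans gj1 (gmax _ isT).
pose J := [set j : 'I_m | (theta * g j0 <= g j)%R]%SET.
have Jn : (#|J| <= n)%N by apply: generic => // j; exact: gmax.
have Jj0 : j0 \in J by rewrite inE ler_piMl.
have := vdm J j0 Jj0 Jn y; rewrite yE.
have le1 : \sum_(k < n) modulus (\sum_(j < m) j%:R ^+ k * y j) <= n%:R * b.
  rewrite -[n in n%:R]card_ord -sumr_const mulr_suml; apply: ler_sum => k _.
  by rewrite mul1r -peval_power_sum.
have le2 : \sum_(j | j \notin J) modulus (y j) <= m%:R * (theta ^+ M * g j0 ^+ M).
  rewrite -[m in m%:R]card_ord -sumr_const mulr_suml [leRHS](bigID (mem J)) /=.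
  rewrite ler_wpDl ?sumr_ge0//.
    by move=> j _; rewrite mul1r mulr_ge0 ?exprn_ge0// ltW.
  apply: ler_sum => j; rewrite inE -ltNge => jJ.
  rewrite yE mul1r -exprMn lerXn2r ?nnegrE//; last exact: ltW.
  by rewrite mulr_ge0// ltW.
set X := g j0 ^+ M; have X0 : 0 <= X by rewrite exprn_ge0.
rewrite -/X in le2; set S1 := \sum_(k < n) _ in le1 *.
set S2 := \sum_(j | _) _ in le2 *.
move=> XS.
have h1 : A * (S1 + S2) <= A * (n%:R * b + m%:R * (theta ^+ M * X)).
  by rewrite ler_wpM2l// lerD.
have h2 : 2 * A * m%:R * theta ^+ M * X <= X by rewrite ler_piMl.
by move: XS h1 h2; set T := theta ^+ M; lra.
Qed.

Lemma modulus_power_sum_le (R : realType) (n m M : nat) (a : 'I_m -> multinom n)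
    (c : 'I_m -> R) (z : Cn R n) (b : R) (k : nat) :
  (forall j, 0 < c j) -> (forall j, c j * monomial_modulus (a j) z <= b) ->
  modulus (peval (power_sum c a M (fun j => j%:R ^+ k)) z) <=
    (\sum_(j < m) j%:R ^+ k) * b ^+ M.
Proof.
move=> c0 cb; rewrite peval_power_sum; apply: le_trans (modulus_sum _ _ _) _.
rewrite mulr_suml; apply: ler_sum => j _.
have g0 : 0 <= c j * monomial_modulus (a j) z.
  by rewrite mulr_ge0 ?monomial_modulus_ge0 ?(ltW (c0 j)).
rewrite modulusM modulus_power_term ?(ltW (c0 j))// modulusX.
have -> : modulus (j%:R : Cplx R) = j%:R.
  by have := modulus_natB R j 0; rewrite !subr0 normr_nat.
by rewrite ler_wpM2l ?exprn_ge0// lerXn2r ?nnegrE// (le_trans g0).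
Qed.

(** * Choice of the constants and the two inclusions *)

Theorem corollary1p2 (R : realType) (n : nat) (D : set 'rV[Cplx R]_n)
    (eps : R) :
  domain D -> bounded_set D -> reinhardt D -> polynomially_convex D ->
  0 < eps ->
  exists (d : nat) (p : 'I_n -> cpoly R n),
    [/\ forall k, homogeneous d (p k),
        forall z : 'rV[Cplx R]_n, (forall k, peval (p k) z = 0) <-> z = 0,
        closure D `<=` [set z | forall k, `|peval (p k) z| < 1]
      & [set z | forall k, `|peval (p k) z| < 1] `<=` dilate (1 + eps) D].
Proof.
move=> dD bD rD pD eps0.
(* Four factors [rho] are spent: one on separation by monomials, one on perturbing the coefficients,
   one each on absorbing [C0] and [2 * A * n%:R]. *)
pose rho := Num.sqrt (Num.sqrt (1 + eps)).
have rho4 : rho ^+ 4 = 1 + eps.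
  by rewrite (exprM _ 2 2) !sqr_sqrtr ?sqrtr_ge0//; lra.
have rho1 : 1 < rho.
  rewrite ltNge; apply/negP => r1.
  by have := exprn_ile1 4 (sqrtr_ge0 _) r1; rewrite rho4; lra.
have rho0 : 0 < rho by lra.
have [N [m [a [c [N0 ac cD sep]]]]] := monomial_polyhedron dD bD rD pD rho1.
have aN j := (ac j).1.
have [c' [theta [/andP[theta0 theta1] cc' generic]]] :=
  generic_coefficients N0 aN (fun j => (ac j).2) rho1.
have c'0 j : 0 < c' j by have /andP[+ _] := cc' j; apply: lt_le_trans; exact: (ac j).2.
have [A A0 vdm] := vandermonde_bound R n m.
pose C0 : R := \sum_(k < n) \sum_(j < m) j%:R ^+ k.
have C00 : 0 <= C0.
  by rewrite !sumr_ge0// => k _; rewrite sumr_ge0// => j _; rewrite exprn_ge0.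
pose q := Num.max theta rho^-1.
have q01 : 0 <= q < 1.
  by rewrite /q le_max (ltW theta0)/= gt_max theta1 invf_lt1.
(* [E] dominates every constant to be absorbed by the choice of [M]; its summand 1 excludes [M = 0],
   so the degree [N * M] is positive. *)
pose E := 1 + C0 + 2 * A * m%:R + 2 * A * n%:R.
have E1 : [/\ 0 <= 2 * A * m%:R & 0 <= 2 * A * n%:R] by rewrite !mulr_ge0// ltW.
case: E1 => Em En.
have E0 : 0 < E by rewrite /E; lra.
have [M EM] := pow_small q01 E0.
have M0 : (0 < M)%N.
  by case: M EM => //; rewrite expr0 mulr1 /E; lra.
have qM x : 0 <= x <= q -> x ^+ M <= q ^+ M.
  by move=> /andP[x0 xq]; rewrite lerXn2r// nnegrE// (le_trans x0).
have thetaM : theta ^+ M <= q ^+ M by apply: qM; rewrite ltW// le_max lexx.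
pose P := rho ^+ (N * M).
have P1 : 1 <= P by rewrite exprn_ege1// ltW.
have P0 : 0 < P by lra.
have PM : P^-1 <= q ^+ M.
  apply: (@le_trans _ _ (rho^-1 ^+ M)); last first.
    by apply: qM; rewrite invr_ge0 ltW// le_max lexx orbT.
  by rewrite exprVn lef_pV2 ?posrE ?exprn_gt0// ler_weXn2l ?leq_pmull// ltW.
have qM0 : 0 <= q ^+ M by rewrite exprn_ge0//; case/andP: q01.
have EqM x : 0 <= x <= E -> x * q ^+ M <= 1.
  by move=> /andP[x0 xE]; apply: le_trans (ltW EM); rewrite ler_wpM2r.
have cond1 : C0 * P^-1 < 1.
  apply: (@le_lt_trans _ _ (C0 * q ^+ M)); first by rewrite ler_wpM2l.
  apply: le_lt_trans EM; rewrite ler_wpM2r// /E; lra.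
have cond2 : 2 * A * m%:R * theta ^+ M <= 1.
  apply: (@le_trans _ _ (2 * A * m%:R * q ^+ M)); first by rewrite ler_wpM2l.
  by apply: EqM; rewrite Em/= /E; lra.
have cond3 : 2 * A * n%:R <= P.
  rewrite -[leRHS]mul1r -ler_pdivrMr//.
  apply: (@le_trans _ _ (2 * A * n%:R * q ^+ M)); first by rewrite ler_wpM2l.
  by apply: EqM; rewrite En/= /E; lra.
(* The threshold for the power sums is P^2: they are at most C0 P < P^2 on the closure of [D], and 2
   A n P^2 <= P^3 serves outside the dilate. *)
pose p (k : 'I_n) := ofR (P^-1 ^+ 2) *: power_sum c' a M (fun j => j%:R ^+ k).
have hp k : homogeneous (N * M) (p k).
  by apply: rpredZ; exact: homogeneous_power_sum.
have pE k z : modulus (peval (p k) z) =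
    P^-1 ^+ 2 * modulus (peval (power_sum c' a M (fun j => j%:R ^+ k)) z).
  rewrite /peval mevalZ modulusM modulus_ofR.
  by rewrite ger0_norm ?exprn_ge0 ?invr_ge0 ?(ltW P0).
have lt1 k z : (`|peval (p k) z| < 1) = (modulus (peval (p k) z) < 1).
  by rewrite norm_modulus (lt_ofR _ 1).
have sub : [set z | forall k, `|peval (p k) z| < 1] `<=` dilate (1 + eps) D.
  move=> z pz.
  have [Dz|nDz] := pselect (D (ofR (rho ^+ 4)^-1 *: z)).
    exists (ofR (rho ^+ 4)^-1 *: z) => //.
    by rewrite -rho4 ofR_scaleKV// gt_eqF// exprn_gt0.
  pose u := ofR (rho ^+ 3)^-1 *: z.
  have /sep[j cj] : ~ D (ofR rho^-1 *: u).
    by rewrite /u scalerA -ofRM -invfM -exprS.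
  have rN0 : 0 < rho ^+ 3 ^+ N by rewrite !exprn_gt0.
  have gj : rho ^+ 3 ^+ N < c' j * monomial_modulus (a j) z.
    have -> : z = ofR (rho ^+ 3) *: u by rewrite /u ofR_scaleKV// gt_eqF// exprn_gt0.
    rewrite monomial_modulusZ modulus_ofR gtr0_norm ?exprn_gt0// aN mulrCA.
    rewrite ltr_pMr//; apply: lt_le_trans cj _.
    by rewrite ler_wpM2r ?monomial_modulus_ge0//; case/andP: (cc' j).
  have : (c' j * monomial_modulus (a j) z) ^+ M <= 2 * A * n%:R * P ^+ 2.
    apply: (@power_sum_lower_bound _ _ _ _ _ _ theta) => //.
    - exact: ltW.
    - exact: generic.
    - exact: ltW.
    - exact: lt_trans gj.
    move=> k; have := pz k; rewrite lt1 pE exprVn mulrC ltr_pdivrMr ?exprn_gt0// mul1r.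
    exact: ltW.
  (* The left side is P^3, which contradicts the upper bound 2 A n P^2 just obtained. *)
  have : (rho ^+ 3 ^+ N) ^+ M < (c' j * monomial_modulus (a j) z) ^+ M.
    by rewrite ltrXn2r ?gtn_eqF// ltW.
  have -> : (rho ^+ 3 ^+ N) ^+ M = P * P ^+ 2.
    by rewrite -exprS /P -exprM exprAC.
  move=> /lt_le_trans/[apply]; rewrite ltr_pM2r ?exprn_gt0// => /lt_le_trans/(_ cond3).
  by rewrite ltxx.
exists (N * M)%N, p; split => //.
(* The inclusion already proved bounds the polyhedron, which rules out nonzero common zeros. *)
- have [B B0 DB] := bounded_modulus bD.
  move=> z; apply: (@homogeneous_common_zero _ _ (N * M) p ((1 + eps) * B)) => //.
    by rewrite muln_gt0 N0.
  move=> v /sub[w Dw <-] i; rewrite mxE modulusM modulus_ofR ger0_norm; last by lra.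
  by rewrite ler_wpM2l ?DB//; lra.
- move=> z cz k /=; rewrite lt1 pE.
  have g j : c' j * monomial_modulus (a j) z <= rho.
    apply: (@le_trans _ _ (rho * c j * monomial_modulus (a j) z)).
      by rewrite ler_wpM2r ?monomial_modulus_ge0//; case/andP: (cc' j).
    by rewrite -mulrA ler_piMr ?cD// ltW.
  have := modulus_power_sum_le M k c'0 g.
  set X := modulus _; set s := \sum_(j < m) _ => Xs.
  have s0 : 0 <= s by rewrite sumr_ge0// => j _; rewrite exprn_ge0.
  have sC : s <= C0.
    rewrite /C0 (bigD1 k) //= lerDl sumr_ge0// => i _.
    by rewrite sumr_ge0// => j _; rewrite exprn_ge0.
  have rP : rho ^+ M <= P by rewrite ler_weXn2l ?leq_pmull// ltW.
  have XP : X <= C0 * P.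
    by apply: le_trans Xs _; rewrite ler_pM// exprn_ge0// ltW.
  apply: le_lt_trans cond1.
  rewrite exprVn mulrC ler_pdivrMr ?exprn_gt0//.
  by rewrite expr2 mulrA divfK// gt_eqF.
Qed.
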